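(* De Sitter spacetime $S^{3,1}$ is isomorphic as a $G$-space, $G=\mathrm{SO}_o(4,1)$, to the space of co-oriented 2-spheres in the conformal 3-sphere $P(\mathcal{C})$.
   Context: Let $\mathbb{R}^{4,1}$ be $\mathbb{R}^5$ with the Minkowski inner product $\eta=\mathrm{diag}(-1,1,1,1,1)$, and let $G=\mathrm{SO}_o(4,1)$ be the identity component of its linear isometry group. De Sitter spacetime is $S^{3,1}=\{x\in\mathbb{R}^{4,1}:\eta(x,x)=1\}$. The projective light cone $P(\mathcal{C})$ is the space of one-dimensional null subspaces of $\mathbb{R}^{4,1}$ (a conformal 3-sphere). $G$ acts on all of these. A 2-sphere in $P(\mathcal{C})$ here means a round sphere in the sense of conformal geometry: a subset of the form $\{[v]\in P(\mathcal{C}): v\in[x]^\perp\}$ for some spacelike vector $x\in\mathbb{R}^{4,1}$ (brackets denote linear span). A co-orientation of such a 2-sphere is a choice of which of the two components of its complement in $P(\mathcal{C})$ is called the ''inside''. All spaces involved are homogeneous $G$-spaces, with manifold structure that of $G$ modulo a closed stabilizer; ''isomorphic as a $G$-space'' means there is a $G$-equivariant diffeomorphism. *)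

(* Defs.v *)
From HB Require Import structures.
From mathcomp Require Import all_boot all_order all_algebra.
From mathcomp Require Import all_classical all_reals all_analysis.

Set Implicit Arguments.
Unset Strict Implicit.
Unset Printing Implicit Defensive.

Import Order.TTheory GRing.Theory Num.Theory.
Import numFieldNormedType.Exports.

Local Open Scope classical_set_scope.
Local Open Scope ring_scope.

(* Coordinate 0 of R^{4,1} is the timelike one; vectors are columns. *)
Definition minkowski_mx (R : realType) : 'M[R]_5 :=
  diag_mx (\row_(i < 5) (if i == 0 then -1 else 1)).

Definition eta (R : realType) (x y : 'cV[R]_5) : R :=
  (x^T *m minkowski_mx R *m y) 0 0.

Definition O41 (R : realType) : set 'M[R]_5 :=
  [set g | forall x y : 'cV[R]_5, eta (g *m x) (g *m y) = eta x y].

Definition SOo41 (R : realType) : set 'M[R]_5 :=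
  connected_component (@O41 R) 1%:M.

Definition null_line (R : realType) (L : {vspace 'cV[R]_5}) : bool :=
  (\dim L == 1%N) && `[< forall v, v \in L -> eta v v = 0 >].

Record pcone (R : realType) := PCone {
  pc_line :> {vspace 'cV[R]_5};
  pc_null : null_line pc_line }.

HB.instance Definition _ (R : realType) := [isSub for @pc_line R].
HB.instance Definition _ (R : realType) := [Choice of pcone R by <:].

Definition punctured_cone (R : realType) : set 'cV[R]_5 :=
  [set v | v != 0 /\ eta v v = 0].

(* The topology of the projective light cone is the quotient topology along
   v |-> <[v]> from the punctured cone. *)
Definition pcone_preimage (R : realType) (U : set (pcone R)) : set 'cV[R]_5 :=
  [set v | exists2 L : pcone R, U L & (L : {vspace 'cV[R]_5}) = <[v]>%VS].

Definition pcone_open (R : realType) (U : set (pcone R)) : Prop :=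
  open (pcone_preimage U : set (subspace (@punctured_cone R))).

Lemma vline_null (R : realType) (v : 'cV[R]_5) :
  punctured_cone v -> null_line <[v]>%VS.
Proof.
move=> [v0 vv]; apply/andP; split; first by rewrite dim_vline v0.
apply/asboolP => _ /vlineP[k ->].
by rewrite /eta -scalemxAr mxE [_^T]linearZ /= -!scalemxAl mxE -/(eta v v) vv !mulr0.
Qed.

Lemma pcone_openT (R : realType) : pcone_open (@setT (pcone R)).
Proof.
apply/open_subspaceP; exists setT; first exact: openT.
apply/seteqP; split=> v [_ vC]; split=> //.
by exists (PCone (vline_null vC)).
Qed.

Lemma pcone_openI (R : realType) : setI_closed (@pcone_open R).
Proof.
move=> A B oA oB; rewrite /pcone_open.
suff -> : pcone_preimage (A `&` B) = pcone_preimage A `&` pcone_preimage B.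
  exact: openI.
apply/seteqP; split=> [v [L [AL BL] Lv]|v [[L AL Lv] [M BM Mv]]].
  by split; exists L.
exists L => //; split=> //.
by have -> : L = M by apply: val_inj; rewrite /= Lv Mv.
Qed.

Lemma pcone_open_bigU (R : realType) (I : Type) (f : I -> set (pcone R)) :
  (forall i, pcone_open (f i)) -> pcone_open (\bigcup_i f i).
Proof.
move=> of_; rewrite /pcone_open.
suff -> : pcone_preimage (\bigcup_i f i) = \bigcup_i pcone_preimage (f i).
  by apply: bigcup_open => i _; exact: of_.
apply/seteqP; split=> [v [L [i _ fL] Lv]|v [i _ [L fL Lv]]].
  by exists i => //; exists L.
by exists L => //; exists i.
Qed.

HB.instance Definition _ (R : realType) :=
  isOpenTopological.Build (pcone R) (@pcone_openT R) (@pcone_openI R)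
    (@pcone_open_bigU R).

Definition sphere2 (R : realType) (S : set (pcone R)) : Prop :=
  exists2 x : 'cV[R]_5, 0 < eta x x &
    S = [set L | exists2 v, eta v x = 0 & (L : {vspace 'cV[R]_5}) = <[v]>%VS].

Definition component_of (T : topologicalType) (A C : set T) : Prop :=
  exists2 p, A p & C = connected_component A p.

(* A co-oriented 2-sphere is a pair (sphere, inside). *)
Definition cooriented_sphere2 (R : realType) :
    set (set (pcone R) * set (pcone R)) :=
  [set c | sphere2 c.1 /\ component_of (~` c.1) c.2].

Definition line_act (R : realType) (g : 'M[R]_5) (L : {vspace 'cV[R]_5}) :
    {vspace 'cV[R]_5} :=
  (linfun (mulmx g) @: L)%VS.

(* The image g A, stated without first proving that g preserves null lines. *)
Definition pcone_set_act (R : realType) (g : 'M[R]_5) (A : set (pcone R)) :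
    set (pcone R) :=
  [set M | exists2 L : pcone R, A L & pc_line M = line_act g L].

(* Data of a G-space for G = SO_o(4,1): a subset of an ambient type, and a
   map defined on all matrices and all ambient points.  Only its values at
   g in G and x in gs_pts matter; that these form an action is part of
   [homogeneous]. *)
Record gspace (R : realType) := GSpace {
  gs_ambient : Type;
  gs_pts : set gs_ambient;
  gs_act : 'M[R]_5 -> gs_ambient -> gs_ambient }.
Arguments gs_ambient {R} X : rename.
Arguments gs_pts {R} X : rename.
Arguments gs_act {R} X g x : rename.

Definition de_sitter (R : realType) : gspace R :=
  GSpace [set x : 'cV[R]_5 | eta x x = 1] (fun g x => g *m x).

Definition cooriented_spheres (R : realType) : gspace R :=
  GSpace (@cooriented_sphere2 R)
    (fun g c => (pcone_set_act g c.1, pcone_set_act g c.2)).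

Definition stabilizer (R : realType) (X : gspace R) (x : gs_ambient X) :
    set 'M[R]_5 :=
  [set g | SOo41 g /\ gs_act X g x = x].
Arguments stabilizer {R} X x _.

Definition homogeneous (R : realType) (X : gspace R) : Prop :=
  [/\ gs_pts X !=set0,
      forall g x, SOo41 g -> gs_pts X x -> gs_pts X (gs_act X g x),
      (forall x, gs_pts X x -> gs_act X 1%:M x = x) /\
      (forall g h x, SOo41 g -> SOo41 h -> gs_pts X x ->
         gs_act X (g *m h) x = gs_act X g (gs_act X h x)),
      forall x y, gs_pts X x -> gs_pts X y ->
         exists2 g, SOo41 g & gs_act X g x = y &
      forall x, gs_pts X x ->
         closed (stabilizer X x : set (subspace (@SOo41 R)))].

(* C^n on V: all iterated directional derivatives up to order n exist and are
   continuous at the points of V. *)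
Fixpoint Cn (R : realType) (n : nat) (V : set 'M[R]_5) (f : 'M[R]_5 -> R) :
    Prop :=
  (forall x, V x -> {for x, continuous f}) /\
  if n is m.+1 then
    forall v : 'M[R]_5,
      (forall x, V x -> derivable f x v) /\ Cn m V (fun x => 'D_v f x)
  else True.

(* Smooth function on a subset A of the space of matrices.  It is used for A
   relatively open in G, an embedded submanifold, where smooth functions are
   the local restrictions of smooth functions of the matrix entries. *)
Definition smooth_on (R : realType) (A : set 'M[R]_5) (f : 'M[R]_5 -> R) :
    Prop :=
  forall a, A a -> exists V F,
    [/\ open V, V a, (forall n, Cn n V F) &
        forall g, V g -> A g -> f g = F g].

(* The manifold structure of X = G/Stab(x), given by its open sets and its
   sheaf of smooth functions: U is open, resp. f : U -> R is smooth, when its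
   pullback along the orbit map g |-> g x is open, resp. smooth, in G.
   For homogeneous X these do not depend on the base point x. *)
Definition orbit_preimage (R : realType) (X : gspace R) (x : gs_ambient X)
    (U : set (gs_ambient X)) : set 'M[R]_5 :=
  [set g | SOo41 g /\ U (gs_act X g x)].
Arguments orbit_preimage {R} X x U _.

Definition gs_open (R : realType) (X : gspace R) (U : set (gs_ambient X)) :
    Prop :=
  U `<=` gs_pts X /\
  forall x, gs_pts X x ->
    open (orbit_preimage X x U : set (subspace (@SOo41 R))).
Arguments gs_open {R} X U.

Definition gs_smooth (R : realType) (X : gspace R) (U : set (gs_ambient X))
    (f : gs_ambient X -> R) : Prop :=
  forall x, gs_pts X x ->
    smooth_on (orbit_preimage X x U) (fun g => f (gs_act X g x)).
Arguments gs_smooth {R} X U f.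

(* Smooth maps are the continuous maps pulling smooth functions on open sets
   back to smooth functions. *)
Definition smooth_map (R : realType) (X Y : gspace R)
    (phi : gs_ambient X -> gs_ambient Y) : Prop :=
  (forall x, gs_pts X x -> gs_pts Y (phi x)) /\
  forall V, gs_open Y V ->
    gs_open X (gs_pts X `&` phi @^-1` V) /\
    forall f : gs_ambient Y -> R, gs_smooth Y V f ->
      gs_smooth X (gs_pts X `&` phi @^-1` V) (f \o phi).
Arguments smooth_map {R} X Y phi.

Definition diffeomorphism (R : realType) (X Y : gspace R)
    (phi : gs_ambient X -> gs_ambient Y) : Prop :=
  smooth_map X Y phi /\
  exists psi : gs_ambient Y -> gs_ambient X,
    [/\ smooth_map Y X psi,
        forall x, gs_pts X x -> psi (phi x) = x &
        forall y, gs_pts Y y -> phi (psi y) = y].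
Arguments diffeomorphism {R} X Y phi.

Definition equivariant (R : realType) (X Y : gspace R)
    (phi : gs_ambient X -> gs_ambient Y) : Prop :=
  forall g x, SOo41 g -> gs_pts X x -> phi (gs_act X g x) = gs_act Y g (phi x).
Arguments equivariant {R} X Y phi.

Definition isomorphic_gspaces (R : realType) (X Y : gspace R) : Prop :=
  exists phi : gs_ambient X -> gs_ambient Y,
    equivariant X Y phi /\ diffeomorphism X Y phi.

(* Main.v *)
Require Import Defs.
From mathcomp Require Import all_boot all_order all_algebra.
From mathcomp Require Import all_classical all_reals all_analysis.
From mathcomp Require Import ring lra.

(* A unit spacelike vector [x] is sent to the sphere cut out by its orthogonal
   complement, co-oriented by the cap of future null directions pairing
   positively with [x].

   Elements of [SOo41] come from pairs of reflections: if the segment from [a]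
   to [b] avoids null vectors then [refl b *m refl a] is joined to
   [refl a *m refl a = 1].  For unit [x], [y] with [eta x y > -1] the product
   [refl (x + y) *m refl x] carries [x] to [y], and any two points of de Sitter
   space are joined through a unit vector orthogonal to both.

   The complement of the sphere is the disjoint union of the open caps of [x]
   and [- x]; each is connected because the segment between two future null
   vectors is causal and can be pushed along [x] back to the cone.  Since the
   manifold structures are those of orbits, an equivariant bijection is
   automatically a diffeomorphism. *)

Set Implicit Arguments.
Unset Strict Implicit.
Unset Printing Implicit Defensive.

Import Order.TTheory GRing.Theory Num.Theory.
Import numFieldNormedType.Exports.

Local Open Scope classical_set_scope.
Local Open Scope ring_scope.

(** * Convergence of matrix-valued maps *)

Lemma cvg_sum (R : realType) (V : normedModType R) (T I : Type)
    (F : set_system T) {FF : Filter F} (r : seq I) (f : I -> T -> V)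
    (a : I -> V) :
  (forall i, f i @ F --> a i) ->
  (fun t => \sum_(i <- r) f i t) @ F --> \sum_(i <- r) a i.
Proof. by move=> fa; apply: cvg_big => //; exact: add_continuous. Qed.

Lemma cvg_mxP (R : realType) (T : Type) (F : set_system T) {FF : Filter F} m n
    (A : T -> 'M[R]_(m, n)) (a : 'M[R]_(m, n)) :
  A @ F --> a <-> forall i j, (fun t => A t i j) @ F --> a i j.
Proof.
split=> [cA i j|cA].
  exact: (cvg_comp _ _ cA (@coord_continuous R m n i j a)).
have -> : A = fun t => \sum_i \sum_j A t i j *: delta_mx i j.
  by apply/funext => t; rewrite -matrix_sum_delta.
rewrite [a]matrix_sum_delta.
apply: cvg_sum => i; apply: cvg_sum => j.
exact: cvgZr_tmp.
Qed.

Lemma cvg_mulmx (R : realType) (T : Type) (F : set_system T) {FF : Filter F}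
    m n p (A : T -> 'M[R]_(m, n)) (B : T -> 'M[R]_(n, p))
    (a : 'M[R]_(m, n)) (b : 'M[R]_(n, p)) :
  A @ F --> a -> B @ F --> b -> (fun t => A t *m B t) @ F --> a *m b.
Proof.
move=> /cvg_mxP cA /cvg_mxP cB; apply/cvg_mxP => i j.
under eq_fun do rewrite mxE; rewrite mxE.
by apply: cvg_sum => k; apply: cvgM.
Qed.

Lemma cvg_trmx (R : realType) (T : Type) (F : set_system T) {FF : Filter F}
    m n (A : T -> 'M[R]_(m, n)) (a : 'M[R]_(m, n)) :
  A @ F --> a -> (fun t => (A t)^T) @ F --> a^T.
Proof.
move=> /cvg_mxP cA; apply/cvg_mxP => i j.
under eq_fun do rewrite mxE.
by rewrite mxE; exact: cA.
Qed.

(** * The Minkowski form and its isometry group *)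

Section Eta.
Variable R : realType.
Implicit Types (x y z v : 'cV[R]_5) (a : R).

Lemma etaE x y :
  eta x y = - (x 0 0 * y 0 0)
    + \sum_(i < 4) x (lift ord0 i) 0 * y (lift ord0 i) 0.
Proof.
rewrite /eta -mulmxA mul_diag_mx mxE big_ord_recl !mxE eqxx.
rewrite mulN1r mulrN; congr (_ + _).
by apply: eq_bigr => i _; rewrite !mxE /= mul1r.
Qed.

Lemma etaC x y : eta x y = eta y x.
Proof.
by rewrite !etaE mulrC; congr (_ + _); apply: eq_bigr => i _; rewrite mulrC.
Qed.

Lemma etaDr x y z : eta x (y + z) = eta x y + eta x z.
Proof. by rewrite /eta mulmxDr mxE. Qed.

Lemma etaZr a x y : eta x (a *: y) = a * eta x y.
Proof. by rewrite /eta -scalemxAr mxE. Qed.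

Lemma etaDl x y z : eta (x + y) z = eta x z + eta y z.
Proof. by rewrite etaC etaDr !(etaC z). Qed.

Lemma etaZl a x y : eta (a *: x) y = a * eta x y.
Proof. by rewrite etaC etaZr etaC. Qed.

Lemma etaNr x y : eta x (- y) = - eta x y.
Proof. by rewrite -scaleN1r etaZr mulN1r. Qed.

Lemma etaNl x y : eta (- x) y = - eta x y.
Proof. by rewrite etaC etaNr etaC. Qed.

Definition etaLin := (etaDl, etaDr, etaNl, etaNr, etaZl, etaZr).

Lemma cvg_eta (T : Type) (F : set_system T) {FF : Filter F}
    (f g : T -> 'cV[R]_5) x y :
  f @ F --> x -> g @ F --> y -> (fun t => eta (f t) (g t)) @ F --> eta x y.
Proof.
move=> cf cg.
have /cvg_mxP :
    (fun t => (f t)^T *m minkowski_mx R *m g t) @ F --> x^T *m minkowski_mx R *m y.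
  by do 2![apply: cvg_mulmx => //]; [exact: cvg_trmx|exact: cvg_cst].
exact.
Qed.

Lemma eta_delta0 x : eta x (delta_mx 0 0) = - x 0 0.
Proof.
rewrite etaE big1 ?addr0 => [|i _]; rewrite !mxE ?mulr1 //.
by rewrite andbC /= mulr0.
Qed.

Lemma eta_deltaS x (i : 'I_4) :
  eta x (delta_mx (lift ord0 i) 0) = x (lift ord0 i) 0.
Proof.
rewrite etaE !mxE /= mulr0 oppr0 add0r (bigD1 i) //= big1 ?addr0 => [|j ji].
  by rewrite !mxE !eqxx mulr1.
by rewrite !mxE (inj_eq lift_inj) (negbTE ji) mulr0.
Qed.

Lemma eta_nondegenerate x : (forall y, eta x y = 0) -> x = 0.
Proof.
move=> x0; apply/colP => i; rewrite mxE.
case: (unliftP 0 i) => [j ->|->]; first by rewrite -eta_deltaS.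
by apply: oppr_inj; rewrite -eta_delta0 x0 oppr0.
Qed.

(** A vector killed by [g] is orthogonal to everything, hence zero by nondegeneracy. *)
Lemma O41_unit (g : 'M[R]_5) : O41 g -> g \in unitmx.
Proof.
move=> Og; rewrite -unitmx_tr -row_free_unit -kermx_eq0.
apply/eqP/row_matrixP => i; rewrite row0.
have : row i (kermx g^T) *m g^T = 0 by apply/sub_kermxP; exact: row_sub.
move=> /(congr1 trmx); rewrite trmx_mul trmxK trmx0 => h.
apply: trmx_inj; rewrite trmx0; apply: eta_nondegenerate => y.
by rewrite -Og h /eta trmx0 !mul0mx mxE.
Qed.

Lemma O41_mul (g h : 'M[R]_5) : O41 g -> O41 h -> O41 (g *m h).
Proof. by move=> Og Oh x y; rewrite -!mulmxA Og Oh. Qed.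

Lemma O41_inv (g : 'M[R]_5) : O41 g -> O41 (invmx g).
Proof. by move=> Og x y; rewrite -Og !mulKVmx // O41_unit. Qed.

Lemma O41_1 : O41 (1%:M : 'M[R]_5).
Proof. by move=> x y; rewrite !mul1mx. Qed.

Lemma SOo41_sub : @SOo41 R `<=` @O41 R.
Proof. exact: connected_component_sub. Qed.

Lemma SOo41_1 : SOo41 (1%:M : 'M[R]_5).
Proof. exact: connected_component_refl O41_1. Qed.

Lemma connected_mulmx (g : 'M[R]_5) (C : set 'M[R]_5) :
  connected C -> connected (mulmx g @` C).
Proof.
move=> cC; apply: connected_continuous_connected => //.
apply: continuous_subspaceT => h.
have Fh : Filter (nbhs h) by exact: nbhs_filter.
have cg : (fun=> g) @ h --> g by exact: cvg_cst.
have ch : id @ h --> h by exact: cvg_id.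
exact: cvg_mulmx cg ch.
Qed.

(** Left translation by [invmx g] carries the component to a connected set containing 1, the image
    of [g], and [invmx g], the image of 1. *)
Lemma SOo41_inv (g : 'M[R]_5) : SOo41 g -> SOo41 (invmx g).
Proof.
move=> Gg; have Og := SOo41_sub Gg; have Ug := O41_unit Og.
exists (mulmx (invmx g) @` @SOo41 R).
  split; first by exists g; rewrite ?mulVmx.
    by move=> _ [h Gh <-]; apply: O41_mul (O41_inv Og) (SOo41_sub Gh).
  exact/connected_mulmx/component_connected.
by exists 1%:M; [exact: SOo41_1|rewrite mulmx1].
Qed.

Lemma SOo41_mul (g h : 'M[R]_5) : SOo41 g -> SOo41 h -> SOo41 (g *m h).
Proof.
move=> Gg Gh; have Og := SOo41_sub Gg; have Ug := O41_unit Og.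
apply: connected_component_trans Gg _.
exists (mulmx g @` @SOo41 R).
  split; first by exists 1%:M; [exact: SOo41_1|rewrite mulmx1].
    by move=> _ [k Gk <-]; apply: O41_mul Og (SOo41_sub Gk).
  exact/connected_mulmx/component_connected.
by exists h.
Qed.

End Eta.

(** * Reflections, transitivity and time orientation *)

Lemma mulmx_col_inj (R : pzSemiRingType) m n (A B : 'M[R]_(m, n)) :
  (forall v : 'cV_n, A *m v = B *m v) -> A = B.
Proof.
move=> AB; apply/matrixP => i j.
by have := AB (delta_mx j 0); rewrite -!colE => /colP/(_ i); rewrite !mxE.
Qed.

Lemma connected_pos (R : realType) (T : topologicalType) (A : set T)
    (f : T -> R) a b :
  connected A -> {within A, continuous f} -> (forall t, A t -> f t != 0) ->
  A a -> A b -> 0 < f a -> 0 < f b.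
Proof.
move=> cA cf f0 Aa Ab fa; rewrite ltNge; apply/negP => fb.
have /connected_intervalP fA := connected_continuous_connected cA cf.
have [|||t At ft] := fA (f b) (f a) _ _ 0; first by exists b.
- by exists a.
- by rewrite fb ltW.
by have := f0 t At; rewrite ft eqxx.
Qed.

Section Reflections.
Variable R : realType.
Implicit Types (x y z v w a : 'cV[R]_5).

(** For non-null [a], the reflection in the hyperplane orthogonal to [a]. *)
Definition refl a : 'M[R]_5 :=
  1%:M - (2 / eta a a) *: (a *m (a^T *m minkowski_mx R)).

Lemma mul_refl a v : refl a *m v = v - (2 * eta a v / eta a a) *: a.
Proof.
rewrite mulmxBl mul1mx -scalemxAl -mulmxA.
rewrite [_ *m minkowski_mx R *m v]mx11_scalar -/(eta a v) mul_mx_scalar.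
by rewrite scalerA mulrAC.
Qed.

Lemma refl_O41 a : eta a a != 0 -> O41 (refl a).
Proof.
move=> a0 v w; rewrite !mul_refl !etaLin (etaC v a).
by field.
Qed.

Lemma reflK a : eta a a != 0 -> refl a *m refl a = 1%:M.
Proof.
move=> a0; apply: mulmx_col_inj => v; rewrite -mulmxA mul1mx !mul_refl !etaLin.
rewrite -addrA -opprD -scalerDl [X in X *: a](_ : _ = 0) ?scale0r ?subr0 //.
by field.
Qed.

Lemma cvg_refl (T : Type) (F : set_system T) {FF : Filter F}
    (f : T -> 'cV[R]_5) a :
  eta a a != 0 -> f @ F --> a -> (fun t => refl (f t)) @ F --> refl a.
Proof.
move=> a0 fa; apply: cvgB; first exact: cvg_cst.
apply: cvgZ.
  apply: cvgM; first exact: cvg_cst.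
  by apply: cvgV => //; exact: cvg_eta.
apply: cvg_mulmx => //; apply: cvg_mulmx; last exact: cvg_cst.
exact: cvg_trmx.
Qed.

Lemma cvg_line x y (t : R) : (fun s : R => x + s *: y) @ t --> x + t *: y.
Proof. by apply: cvgD; [exact: cvg_cst|apply: cvgZr_tmp; exact: cvg_id]. Qed.

Lemma refl_SOo41 x y :
  (forall t, 0 <= t <= 1 -> eta (x + t *: y) (x + t *: y) != 0) ->
  SOo41 (refl (x + y) *m refl x).
Proof.
move=> xy0; have x0 : eta x x != 0.
  by have := xy0 0; rewrite scale0r addr0 lexx ler01; apply.
exists ((fun t => refl (x + t *: y) *m refl x) @` `[0, 1]); last first.
  by exists 1; rewrite ?scale1r //= in_itv /= lexx ler01.
split.
- by exists 0; [rewrite /= in_itv /= lexx ler01|rewrite scale0r addr0 reflK].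
- move=> _ [t /= t01 <-]; apply: O41_mul; apply: refl_O41 => //.
  by apply: xy0; rewrite in_itv in t01.
- apply: connected_continuous_connected; first exact: segment_connected.
  apply: continuous_in_subspaceT => t; rewrite inE /= in_itv /= => t01.
  apply: cvg_mulmx; last exact: cvg_cst.
  by apply: cvg_refl; [exact: xy0|exact: cvg_line].
Qed.

Lemma SOo41_move x y : eta x x = 1 -> eta y y = 1 -> -1 < eta x y ->
  exists2 g, SOo41 g & g *m x = y.
Proof.
move=> xx yy xy; exists (refl (x + y) *m refl x).
  apply: refl_SOo41 => t /andP[t0 t1]; rewrite !etaLin xx yy (etaC y x).
  (* The first term is 1 at [t = 0]; the second is positive for [t > 0] since [eta x y > -1]. *)
  rewrite (_ : _ + _ = (1 - t) ^+ 2 + 2 * t * (eta x y + 1)); last by ring.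
  apply: lt0r_neq0; have [->|tN0] := eqVneq t 0; first by lra.
  apply: ltr_wpDl; first exact: sqr_ge0.
  by rewrite !mulr_gt0 // ?lt_neqAle 1?eq_sym ?tN0 //; lra.
(* [refl x] sends [x] to [- x], and [refl (x + y)] sends [- x] to [y] because
   [eta (x + y) (x + y) = 2 * eta (x + y) x]. *)
rewrite -mulmxA !mul_refl !etaLin xx yy (etaC y x).
have s0 : 1 + eta x y + (eta x y + 1) != 0 by apply: lt0r_neq0; lra.
rewrite divr1 mulr1.
have -> : x - 2%:R *: x = - x.
  by rewrite scaler_nat mulr2n opprD addrA subrr sub0r.
rewrite (_ : 2 * _ / _ = -1); last by field.
by rewrite scaleN1r opprK addKr.
Qed.

Lemma orthogonal_exists x y w :
  exists z, [/\ z != 0, eta z x = 0, eta z y = 0 & eta z w = 0].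
Proof.
(* A matrix with 5 rows and 3 columns has a nonzero left kernel; [z] is a row vector in it. *)
pose M := minkowski_mx R *m row_mx x (row_mx y w).
pose z := nz_row (kermx M).
have z0 : z != 0.
  rewrite nz_row_eq0 -mxrank_eq0 mxrank_ker.
  by rewrite -lt0n subn_gt0 (leq_ltn_trans (rank_leq_col _)).
have : z *m M = 0 by apply/sub_kermxP; exact: nz_row_sub.
rewrite mulmxA !mul_mx_row -[0]hsubmxK => /eq_row_mx[zx].
rewrite -[rsubmx 0]hsubmxK => /eq_row_mx[zy zw].
exists z^T; split; rewrite ?trmx_eq0 //.
- by rewrite /eta trmxK zx !mxE.
- by rewrite /eta trmxK zy !mxE.
- by rewrite /eta trmxK zw !mxE.
Qed.

Lemma spatial_gt0 z : z != 0 -> z 0 0 = 0 -> 0 < eta z z.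
Proof.
move=> z0 z00; rewrite etaE z00 mulr0 oppr0 add0r.
rewrite lt_neqAle sumr_ge0 ?andbT => [|i _]; last by rewrite -expr2 sqr_ge0.
apply: contra z0 => /eqP/esym/eqP.
rewrite psumr_eq0 => [/allP zi|i _]; last first.
  by rewrite -expr2 sqr_ge0.
apply/eqP/colP => i; rewrite mxE.
case: (unliftP 0 i) => [j ->|-> //].
by have := zi j (mem_index_enum _); rewrite -expr2 sqrf_eq0 => /eqP.
Qed.

Lemma null_time_neq0 v : punctured_cone v -> v 0 0 != 0.
Proof.
move=> [v0 vv]; apply/eqP => v00.
by have := spatial_gt0 v0 v00; rewrite vv ltxx.
Qed.

Lemma SOo41_transitive x y : eta x x = 1 -> eta y y = 1 ->
  exists2 g, SOo41 g & g *m x = y.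
Proof.
(* Orthogonality to the time axis makes [z] spatial, so it normalises to [u]. The moves from [x] to
   [u] and from [u] to [y] have inner product 0, which also covers [y = - x]. *)
move=> xx yy; have [z [z0 zx zy]] := orthogonal_exists x y (delta_mx 0 0).
rewrite eta_delta0 => /eqP; rewrite oppr_eq0 => /eqP z00.
have zz := spatial_gt0 z0 z00.
pose u := (Num.sqrt (eta z z))^-1 *: z.
have uu : eta u u = 1.
  by rewrite !etaLin mulrA -invfM -expr2 sqr_sqrtr ?ltW // mulVf ?gt_eqF.
have [g Gg gx] : exists2 g, SOo41 g & g *m x = u.
  by apply: SOo41_move => //; rewrite etaC !etaLin zx mulr0; lra.
have [h Gh hu] : exists2 h, SOo41 h & h *m u = y.
  by apply: SOo41_move => //; rewrite !etaLin zy mulr0; lra.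
exists (h *m g); first exact: SOo41_mul.
by rewrite -mulmxA gx.
Qed.

Lemma mulmxr_continuous v : continuous (fun g : 'M[R]_5 => g *m v).
Proof.
move=> g; have Fg : Filter (nbhs g) by exact: nbhs_filter.
have cg : id @ g --> g by exact: cvg_id.
have cv : (fun=> v) @ g --> v by exact: cvg_cst.
exact: cvg_mulmx cg cv.
Qed.

Lemma O41_cone (g : 'M[R]_5) v :
  O41 g -> punctured_cone v -> punctured_cone (g *m v).
Proof.
move=> Og [v0 vv]; split; last by rewrite Og.
apply: contra v0 => /eqP/(congr1 (mulmx (invmx g))).
by rewrite mulKmx ?O41_unit // mulmx0 => ->.
Qed.

(** The time coordinate of [h *m v] never vanishes as [h] runs over the connected group, and it is
    positive at [h = 1]. *)
Lemma SOo41_future (g : 'M[R]_5) v : SOo41 g -> punctured_cone v ->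
  0 < v 0 0 -> 0 < (g *m v) 0 0.
Proof.
move=> Gg vC v0.
have := @connected_pos R _ (@SOo41 R) (fun h => (h *m v) 0 0) 1%:M g.
apply => //; last by rewrite mul1mx.
- exact: component_connected.
- apply: continuous_subspaceT => h.
  exact: continuous_comp (@mulmxr_continuous v h)
    (@coord_continuous R _ _ _ _ _).
- by move=> h /SOo41_sub Oh; exact/null_time_neq0/O41_cone.
- exact: SOo41_1.
Qed.

End Reflections.

(** * Spheres and caps in the projective light cone *)

Section Cone.
Variable R : realType.
Implicit Types (x y z v w : 'cV[R]_5) (L M : pcone R).

Definition polar_sphere x : set (pcone R) :=
  [set L | exists2 v, eta v x = 0 & (L : {vspace 'cV[R]_5}) = <[v]>%VS].

(** The sign of [eta v x] flips with [v], so a future representative is imposed. *)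
Definition cap x : set (pcone R) :=
  [set L | exists v, [/\ 0 < v 0 0, 0 < eta v x &
                        (L : {vspace 'cV[R]_5}) = <[v]>%VS]].

Lemma pc_line_punctured L v : pc_line L = <[v]>%VS -> punctured_cone v.
Proof.
move=> Lv; have /andP[/eqP dL /asboolP nL] := pc_null L; split.
  by apply/eqP => v0; move: dL; rewrite Lv v0 dim_vline eqxx.
by apply: nL; rewrite Lv memv_line.
Qed.

Lemma pc_lineZ L v k : k != 0 ->
  pc_line L = <[v]>%VS -> pc_line L = <[k *: v]>%VS.
Proof.
move=> k0 Lv; rewrite Lv; apply/eqP; rewrite eqEsubv -!memvE.
apply/andP; split; last by rewrite memvZ ?memv_line.
by apply/vlineP; exists k^-1; rewrite scalerA mulVf // scale1r.
Qed.

Lemma pc_line_colinear L v w : pc_line L = <[v]>%VS -> pc_line L = <[w]>%VS ->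
  exists2 k, k != 0 & w = k *: v.
Proof.
move=> Lv Lw; have [w0 _] := pc_line_punctured Lw.
have /vlineP[k wk] : w \in <[v]>%VS by rewrite -Lv Lw memv_line.
exists k => //; apply: contra w0 => /eqP k0.
by rewrite wk k0 scale0r.
Qed.

Lemma pc_lineP L : exists2 v : 'cV[R]_5, 0 < v 0 0 & pc_line L = <[v]>%VS.
Proof.
have /andP[/eqP dL _] := pc_null L.
have Lv : pc_line L = <[vpick L]>%VS.
  apply/esym/eqP; rewrite eqEdim -memvE memv_pick dL dim_vline vpick0.
  by rewrite -dimv_eq0 dL.
have := null_time_neq0 (pc_line_punctured Lv).
rewrite neq_lt => /orP[v0|v0]; last by exists (vpick L).
exists ((-1) *: vpick L); last first.
  by apply: pc_lineZ => //; rewrite oppr_eq0 oner_eq0.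
by rewrite mxE mulN1r oppr_gt0.
Qed.

Lemma polar_sphereE x L v :
  pc_line L = <[v]>%VS -> polar_sphere x L <-> eta v x = 0.
Proof.
move=> Lv; split=> [[w wx Lw]|vx]; last by exists v.
by have [k _ ->] := pc_line_colinear Lw Lv; rewrite etaZl wx mulr0.
Qed.

(** Rescaling the representative by [k] multiplies [v 0 0 * eta v x] by [k ^+ 2], so its sign
    depends only on the line. *)
Lemma capE x L v :
  pc_line L = <[v]>%VS -> cap x L <-> 0 < v 0 0 * eta v x.
Proof.
move=> Lv; split=> [[w [w0 wx Lw]]|vx].
  have [k k0 ->] := pc_line_colinear Lw Lv; rewrite etaZl mxE mulrACA.
  by apply: mulr_gt0; [rewrite -expr2 exprn_even_gt0|exact: mulr_gt0].
have [w w0 Lw] := pc_lineP L; exists w; split => //.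
have [k k0 kv] := pc_line_colinear Lw Lv; move: vx.
by rewrite kv etaZl mxE mulrACA -expr2 pmulr_rgt0 ?exprn_even_gt0 // pmulr_rgt0.
Qed.

Lemma polar_sphereZ k x : k != 0 -> polar_sphere (k *: x) = polar_sphere x.
Proof.
move=> k0; apply/seteqP; split=> L [v vx Lv]; exists v => //; move/eqP: vx.
  by rewrite etaZr mulf_eq0 (negbTE k0) => /eqP.
by rewrite etaZr => /eqP->; rewrite mulr0.
Qed.

Lemma polar_sphereN x : polar_sphere (- x) = polar_sphere x.
Proof. by rewrite -scaleN1r polar_sphereZ // oppr_eq0 oner_eq0. Qed.

Lemma capN x L : cap (- x) L <-> ~ polar_sphere x L /\ ~ cap x L.
Proof.
have [v v0 Lv] := pc_lineP L.
rewrite (polar_sphereE x Lv) (capE x Lv) (capE _ Lv).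
rewrite etaNr mulrN oppr_gt0 pmulr_rlt0 // pmulr_rgt0 //.
split=> [vx|[/eqP vx /negP]]; last by rewrite -leNgt le_eqVlt (negbTE vx).
by split=> [vx0|]; [rewrite vx0 ltxx in vx|apply/negP; rewrite -leNgt ltW].
Qed.

Lemma cap_sphere x L : cap x L -> ~ polar_sphere x L.
Proof. by rewrite -{1}[x]opprK => /capN[]; rewrite polar_sphereN. Qed.

Lemma cap_open x : open (cap x).
Proof.
suff : pcone_open (cap x) by [].
apply/open_subspaceP.
exists [set v : 'cV[R]_5 | 0 < v 0 0 * eta v x].
  have := @open_comp _ _ (fun v : 'cV[R]_5 => v 0 0 * eta v x) [set r | 0 < r].
  apply; last exact: open_gt.
  move=> v _; have Fv : Filter (nbhs v) by exact: nbhs_filter.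
  apply: cvgM; first exact: coord_continuous.
  by apply: cvg_eta; [exact: cvg_id|exact: cvg_cst].
apply/seteqP; split=> v [vx vC]; split => //; last first.
  by have [L Lx Lv] := vx; apply/(capE _ Lv).
exists (PCone (vline_null vC)) => //.
exact/(@capE _ (PCone (vline_null vC)) v).
Qed.

(** The projection of the punctured cone onto [pcone R], made total by the default [L]. *)
Definition line_of L v : pcone R :=
  if pselect (punctured_cone v) is left vC then PCone (vline_null vC) else L.

Lemma pc_line_of L v : punctured_cone v -> pc_line (line_of L v) = <[v]>%VS.
Proof. by move=> vC; rewrite /line_of; case: pselect. Qed.

Lemma line_of_continuous L : {within @punctured_cone R, continuous (line_of L)}.
Proof.
apply/continuousP => U oU; have /open_subspaceP[V oV VU] : pcone_open U by [].
apply/open_subspaceP; exists V => //; rewrite VU.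
apply/seteqP; split=> v [vU vC]; split => //.
  have [M UM Mv] := vU; suff LM : line_of L v = M by rewrite -LM in UM.
  by apply: val_inj; rewrite /= pc_line_of.
by exists (line_of L v) => //; rewrite pc_line_of.
Qed.

Lemma eta_future_le0 v w : punctured_cone v -> punctured_cone w ->
  0 < v 0 0 -> 0 < w 0 0 -> eta v w <= 0.
Proof.
(* [d] has zero time coordinate, so it is zero or spacelike, while [eta d d] equals
   [- 2 * v 0 0 * w 0 0 * eta v w]. *)
move=> [_ vv] [_ ww] v0 w0; pose d := w 0 0 *: v - v 0 0 *: w.
have : 0 <= eta d d.
  have [->|dN0] := eqVneq d 0; first by rewrite -(scale0r v) etaZl mul0r.
  by apply/ltW/spatial_gt0 => //; rewrite !mxE mulrC subrr.
rewrite !etaLin vv ww (etaC w v) => h.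
have : 0 <= w 0 0 * v 0 0 * (- eta v w) by nra.
by rewrite pmulr_rge0 ?oppr_ge0 // mulr_gt0.
Qed.

(* [u + s x] for the larger root [s] of [eta (u + s x) (u + s x) = 0], where
   [eta x x = 1]. *)
Definition cone_proj x u : 'cV[R]_5 :=
  u + (Num.sqrt (eta u x ^+ 2 - eta u u) - eta u x) *: x.

Lemma cone_proj_eta x u :
  eta x x = 1 -> eta (cone_proj x u) x = Num.sqrt (eta u x ^+ 2 - eta u u).
Proof. by move=> xx; rewrite /cone_proj !etaLin xx; ring. Qed.

Lemma cone_proj_null x u : eta x x = 1 -> eta u u <= 0 ->
  eta (cone_proj x u) (cone_proj x u) = 0.
Proof.
move=> xx uu; have : 0 <= eta u x ^+ 2 - eta u u.
  by rewrite subr_ge0 (le_trans uu) // sqr_ge0.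
move=> /sqr_sqrtr; rewrite /cone_proj; set s := Num.sqrt _ => ss.
rewrite !etaLin xx (etaC x u).
suff : s ^+ 2 - (eta u x ^+ 2 - eta u u) = 0 by move=> <-; ring.
by rewrite ss subrr.
Qed.

(** When [eta x x = 1], the two roots for a null [v] are 0 and [- 2 * eta v x]; positivity makes 0
    the larger. This fixes the endpoints of the path in [cap_joined]. *)
Lemma cone_proj_id x v : eta v v = 0 -> 0 < eta v x -> cone_proj x v = v.
Proof.
move=> vv vx; rewrite /cone_proj vv subr0 sqrtr_sqr gtr0_norm // subrr.
by rewrite scale0r addr0.
Qed.

Lemma cone_proj_continuous x v w :
  continuous (fun t : R => cone_proj x (v + t *: w)).
Proof.
move=> t; have cl := @cvg_line R v w t.
have cx : (fun s : R => eta (v + s *: w) x) @ t --> eta (v + t *: w) x.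
  by apply: cvg_eta => //; exact: cvg_cst.
apply: cvgD => //; apply: cvgZr_tmp; apply: cvgB => //.
pose q u := eta u x ^+ 2 - eta u u.
have cq : (fun s : R => q (v + s *: w)) @ t --> q (v + t *: w).
  by apply: cvgB; [exact: cvgM|exact: cvg_eta].
exact: cvg_comp cq (@sqrt_continuous R _).
Qed.

Lemma cap_joined x L M : eta x x = 1 -> cap x L -> cap x M ->
  connected_component (~` polar_sphere x) L M.
Proof.
move=> xx [v [v0 vx Lv]] [w [w0 wx Mw]].
have vC := pc_line_punctured Lv; have wC := pc_line_punctured Mw.
pose u (t : R) := v + t *: (w - v).
have uuE t : eta (u t) (u t) = 2 * t * (1 - t) * eta v w.
  by rewrite !etaLin vC.2 wC.2 (etaC w v); ring.
have uu t : 0 <= t <= 1 -> eta (u t) (u t) <= 0.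
  move=> /andP[t0 t1]; have vw := eta_future_le0 vC wC v0 w0.
  by rewrite uuE mulr_ge0_le0 // !mulr_ge0 // subr_ge0.
have ux t : 0 <= t <= 1 -> 0 < eta (u t) x.
  by move=> /andP[t0 t1]; rewrite !etaLin; nra.
(* [u t] is never spacelike and pairs positively with [x], so the square root is positive and the
   projected path stays off the sphere. *)
have px t : 0 <= t <= 1 -> 0 < eta (cone_proj x (u t)) x.
  move=> t01; rewrite cone_proj_eta // sqrtr_gt0 subr_gt0.
  by rewrite (le_lt_trans (uu _ t01)) // exprn_gt0 // ux.
have pC t : 0 <= t <= 1 -> punctured_cone (cone_proj x (u t)).
  move=> t01; split; last by apply: cone_proj_null => //; exact: uu.
  apply/eqP => p0; have := px t t01.
  by rewrite p0 -(scale0r v) etaZl mul0r ltxx.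
pose D := (fun t => cone_proj x (u t)) @` `[0, 1].
have DC : D `<=` @punctured_cone R.
  by move=> _ [t /= t01 <-]; apply: pC; rewrite in_itv in t01.
exists (line_of L @` D); last first.
  exists w; first (exists 1; first by rewrite /= in_itv /= lexx ler01).
    by rewrite /u scale1r addrC subrK cone_proj_id // wC.2.
  by apply: val_inj; rewrite /= pc_line_of.
split.
- exists v; first (exists 0; first by rewrite /= in_itv /= lexx ler01).
    by rewrite /u scale0r addr0 cone_proj_id // vC.2.
  by apply: val_inj; rewrite /= pc_line_of.
- move=> _ [_ [t /= t01 <-] <-]; rewrite in_itv /= in t01.
  rewrite /setC /= (polar_sphereE x (pc_line_of L (pC t t01))).
  by apply/eqP; rewrite gt_eqF // px.
- apply: connected_continuous_connected.
    apply: connected_continuous_connected; first exact: segment_connected.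
    apply: continuous_subspaceT; exact: cone_proj_continuous.
  exact: continuous_subspaceW DC (@line_of_continuous L).
Qed.

(** [cap x] is both open and closed in the complement of the sphere, so a connected set there that
    meets it lies inside it; [cap_joined] gives the other inclusion. *)
Lemma cap_component x L : eta x x = 1 -> cap x L ->
  connected_component (~` polar_sphere x) L = cap x.
Proof.
move=> xx Lx; apply/seteqP; split=> [M [C [CL CS cC] CM]|M Mx]; last first.
  exact: cap_joined.
suff CE : C `&` cap x = C by move: CM; rewrite -CE => -[].
apply: cC; first by exists L.
  by exists (cap x) => //; exact: cap_open.
(* Within the complement of the sphere, [cap x] is what the open set [cap (- x)] leaves. *)
exists (~` cap (- x)); first by apply: open_closedC; exact: cap_open.
apply/seteqP; split=> N [CN xN]; split => //.
  by move=> /capN[].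
by apply: contrapT => xN'; apply: xN; apply/capN; split => //; exact: CS.
Qed.

Lemma cap_nonempty x : eta x x = 1 -> cap x !=set0.
Proof.
(* The spatial coordinates of [x] have squared norm [1 + x 0 0 ^+ 2], so replacing the time
   coordinate by [s] gives a null vector. *)
move=> xx; pose s := Num.sqrt (1 + x 0 0 ^+ 2).
have ss : s ^+ 2 = 1 + x 0 0 ^+ 2.
  by rewrite sqr_sqrtr // addr_ge0 ?ler01 ?sqr_ge0.
have s0 : 0 < s by rewrite sqrtr_gt0 ltr_pwDl ?ltr01 ?sqr_ge0.
have sx : x 0 0 < s by nra.
pose v : 'cV[R]_5 := x + (s - x 0 0) *: delta_mx 0 0.
have v0 : v 0 0 = s by rewrite !mxE /= mulr1 addrC subrK.
have vv : eta v v = 0.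
  rewrite !etaLin xx (etaC _ x) !eta_delta0 mxE /=.
  by transitivity (1 + x 0 0 ^+ 2 - s ^+ 2); [ring|rewrite ss subrr].
have vC : punctured_cone v.
  by split => //; apply/eqP => v00; move: s0; rewrite -v0 v00 mxE ltxx.
exists (PCone (vline_null vC)), v; split => //; first by rewrite v0.
rewrite !etaLin xx (etaC _ x) eta_delta0.
have -> : 1 + (s - x 0 0) * - x 0 0 = (1 + x 0 0 ^+ 2) - s * x 0 0 by ring.
by rewrite -ss subr_gt0 expr2 ltr_pM2l.
Qed.

End Cone.

(** * The bijection between de Sitter points and co-oriented spheres *)

Section Polarity.
Variable R : realType.
Implicit Types (x y v w : 'cV[R]_5) (L M : pcone R) (g : 'M[R]_5).

Lemma line_actE g v : line_act g <[v]>%VS = <[g *m v]>%VS.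
Proof. by rewrite /line_act limg_line lfunE. Qed.

Lemma pcone_set_act_polar g x :
  O41 g -> pcone_set_act g (polar_sphere x) = polar_sphere (g *m x).
Proof.
move=> Og; apply/seteqP; split=> [M [L [v vx Lv] ML]|M [w wx Mw]].
  by exists (g *m v); rewrite ?Og // ML Lv line_actE.
have gw : g *m (invmx g *m w) = w by rewrite mulKVmx ?O41_unit.
have vC := O41_cone (O41_inv Og) (pc_line_punctured Mw).
exists (PCone (vline_null vC)); last by rewrite /= line_actE gw.
by exists (invmx g *m w); rewrite // -Og gw.
Qed.

(** Elements of the identity component preserve future null vectors as well as the form; [invmx g]
    gives the reverse inclusion. *)
Lemma pcone_set_act_cap g x :
  SOo41 g -> pcone_set_act g (cap x) = cap (g *m x).
Proof.
move=> Gg; have Og := SOo41_sub Gg.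
apply/seteqP; split=> [M [L [v [v0 vx Lv]] ML]|M [w [w0 wx Mw]]].
  exists (g *m v); rewrite Og ML Lv line_actE; split => //.
  exact: SOo41_future (pc_line_punctured Lv) v0.
have gw : g *m (invmx g *m w) = w by rewrite mulKVmx ?O41_unit.
have wC := pc_line_punctured Mw; have vC := O41_cone (O41_inv Og) wC.
exists (PCone (vline_null vC)); last by rewrite /= line_actE gw.
exists (invmx g *m w); split => //; last by rewrite -Og gw.
exact: SOo41_future (SOo41_inv Gg) wC w0.
Qed.

Lemma eta_deltaSS (i : 'I_4) :
  eta (delta_mx (lift ord0 i) 0) (delta_mx (lift ord0 i) 0) = 1 :> R.
Proof. by rewrite eta_deltaS mxE !eqxx. Qed.

Definition polarity x : set (pcone R) * set (pcone R) :=
  (polar_sphere x, cap x).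

Lemma polarity_equivariant :
  equivariant (de_sitter R) (cooriented_spheres R) polarity.
Proof.
move=> g x Gg _; rewrite /polarity /= pcone_set_act_cap //.
by rewrite pcone_set_act_polar //; exact: SOo41_sub.
Qed.

Lemma polarity_cooriented x : eta x x = 1 -> cooriented_sphere2 (polarity x).
Proof.
move=> xx; split; first by exists x; rewrite ?xx.
have [L Lx] := cap_nonempty xx; exists L; first exact: cap_sphere.
by rewrite cap_component.
Qed.

Lemma polarity_surj c : cooriented_sphere2 c ->
  exists2 x, eta x x = 1 & polarity x = c.
Proof.
case: c => S I [[x xx /= ->]].
pose k := (Num.sqrt (eta x x))^-1; pose u := k *: x.
have k0 : k != 0 by rewrite invr_neq0 // gt_eqF // sqrtr_gt0.
have uu : eta u u = 1.
  by rewrite !etaLin mulrA -invfM -expr2 sqr_sqrtr ?ltW // mulVf ?gt_eqF.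
rewrite -/(polar_sphere x) -(polar_sphereZ x k0) -/u => -[L Lu ->].
(* The base point [L] of the inside component lies in the cap of [u] or of [- u], which decides the
   sign. *)
have [Lc|Lc] := pselect (cap u L).
  by exists u; rewrite // /polarity cap_component.
have LN : cap (- u) L by apply/capN.
have NN : eta (- u) (- u) = 1 by rewrite etaNl etaNr opprK.
exists (- u); rewrite // /polarity.
by rewrite -(cap_component NN LN) polar_sphereN.
Qed.

(** The null vectors [e_0 + s e_i], with [s] a sign and [e_i] a spatial basis vector other than [e],
    lie on the sphere of [e]. Orthogonality to them leaves [y] a multiple of [e] by 1 or -1, and
    comparing caps excludes -1. *)
Lemma polarity_inj_delta y :
  let e := delta_mx (lift ord0 ord_max) 0 in
  eta y y = 1 -> polarity y = polarity e -> y = e.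
Proof.
move=> e yy [Sy Iy].
have e0 : eta e (delta_mx 0 0) = 0 by rewrite eta_delta0 mxE /= oppr0.
have y_null (i : 'I_4) (s : R) : s ^+ 2 = 1 -> i != ord_max ->
    - y 0 0 + s * y (lift ord0 i) 0 = 0.
  move=> ss im.
  pose v : 'cV[R]_5 := delta_mx 0 0 + s *: delta_mx (lift ord0 i) 0.
  have ve : eta v e = 0.
    rewrite etaC etaDr e0 etaZr eta_deltaS mxE (inj_eq lift_inj) (negbTE im).
    by rewrite mulr0 addr0.
  have vC : punctured_cone v.
    split.
      apply/eqP => /colP/(_ 0); rewrite !mxE /= mulr0 addr0.
      by move/eqP; rewrite oner_eq0.
    rewrite etaDr etaZr eta_delta0 eta_deltaS !mxE /= !eqxx /=.
    by rewrite mulr0 addr0 add0r !mulr1 -expr2 ss addNr.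
  have := polar_sphereE y (erefl (pc_line (PCone (vline_null vC)))).
  rewrite Sy => /iffLR; rewrite etaC etaDr etaZr eta_delta0 eta_deltaS; apply.
  exact/(@polar_sphereE _ e (PCone (vline_null vC)) v).
(* The conditions for [s = 1] and [s = -1] add up to [- 2 * y 0 0 = 0]. *)
have y0 : y 0 0 = 0.
  have := y_null ord0 1 (expr1n _ _) isT.
  have := y_null ord0 (-1) (sqrr_sign _ 1) isT.
  by lra.
have yE : y = y (lift ord0 ord_max) 0 *: e.
  apply/colP => i; rewrite !mxE.
  case: (unliftP 0 i) => [j ->|-> /=]; last first.
    by rewrite y0 mulr0.
  rewrite (inj_eq lift_inj); have [->|jm] := eqVneq j ord_max.
    by rewrite mulr1.
  have := y_null j 1 (expr1n _ _) jm; rewrite y0 oppr0 add0r mul1r => ->.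
  by rewrite /= mulr0.
have ee : eta e e = 1 by exact: eta_deltaSS.
have : eta y y = y (lift ord0 ord_max) 0 ^+ 2.
  by rewrite {1 2}yE !etaLin ee mulr1.
rewrite yy => /esym/eqP; rewrite sqrf_eq1 => /orP[/eqP y1|/eqP y1].
  by rewrite yE y1 scale1r.
have [L Le] := cap_nonempty ee; exfalso.
have := Le; rewrite -Iy yE y1 scaleN1r => /capN[_]; exact.
Qed.

(** Transitivity and equivariance reduce to the case where one point is the last basis vector. *)
Lemma polarity_inj x y : eta x x = 1 -> eta y y = 1 ->
  polarity x = polarity y -> x = y.
Proof.
move=> xx yy xy; pose e : 'cV[R]_5 := delta_mx (lift ord0 ord_max) 0.
have ee : eta e e = 1 by exact: eta_deltaSS.
have [g Gg gx] := SOo41_transitive xx ee.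
have Ug := O41_unit (SOo41_sub Gg).
suff gy : g *m y = e by rewrite -[x](mulKmx Ug) -[y](mulKmx Ug) gx gy.
apply: polarity_inj_delta; first by rewrite (SOo41_sub Gg).
by rewrite -/e -gx !polarity_equivariant // xy.
Qed.

Lemma de_sitter_homogeneous : homogeneous (de_sitter R).
Proof.
split=> /=.
- by exists (delta_mx (lift ord0 ord_max) 0); exact: eta_deltaSS.
- by move=> g x /SOo41_sub Og; rewrite Og.
- by split=> [x _|g h x _ _ _]; rewrite ?mul1mx ?mulmxA.
- exact: SOo41_transitive.
move=> x _; apply/closed_subspaceP.
exists ((fun g => g *m x) @^-1` [set x]).
  apply: closed_comp; last first.
    exact/accessible_closed_set1/hausdorff_accessible/norm_hausdorff.
  move=> g _; exact: mulmxr_continuous.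
by apply/seteqP; split=> g; rewrite /stabilizer /=; tauto.
Qed.

End Polarity.

(** * Equivariant maps and transport of the manifold structure *)

Section Transport.
Variables (R : realType) (X Y : gspace R).
Variable phi : gs_ambient X -> gs_ambient Y.
Hypotheses (hX : homogeneous X) (phiE : equivariant X Y phi).
Hypothesis phi_pts : forall x, gs_pts X x -> gs_pts Y (phi x).

(** By equivariance the orbit map of [phi x] is [phi] after the orbit map of [x]. Openness and
    smoothness are tested along orbit maps, so both pull back. *)
Lemma equivariant_smooth : smooth_map X Y phi.
Proof.
have [_ Xact _ _ _] := hX; split => // V [VY oV]; split.
  split=> [x []//|x Xx].
  rewrite (_ : orbit_preimage X x _ = orbit_preimage Y (phi x) V).
    exact/oV/phi_pts.
  apply/seteqP; split=> g [Gg]; rewrite /orbit_preimage /= -phiE //.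
    by case.
  by move=> Vg; split => //; split => //; exact: Xact.
move=> f sf x Xx g [Gg [Xgx Vgx]].
have [|U [F [oU Ug CF fF]]] := sf (phi x) (phi_pts Xx) g.
  by split => //; rewrite -phiE.
exists U, F; split => // h Uh [Gh [Xhx Vhx]].
rewrite /= phiE //; apply: fF => //; split => //.
by rewrite -phiE.
Qed.

End Transport.

(** Homogeneity moves to [Y] through [phi], and the inverse of [phi] is again equivariant, so
    [equivariant_smooth] applies in both directions. *)
Lemma equivariant_bijection (R : realType) (X Y : gspace R)
    (phi : gs_ambient X -> gs_ambient Y) :
  homogeneous X -> equivariant X Y phi ->
  (forall x, gs_pts X x -> gs_pts Y (phi x)) ->
  (forall y, gs_pts Y y -> exists2 x, gs_pts X x & phi x = y) ->
  (forall x x', gs_pts X x -> gs_pts X x' -> phi x = phi x' -> x = x') ->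
  homogeneous Y /\ diffeomorphism X Y phi.
Proof.
move=> hX phiE phi_pts surj inj.
have [[x0 Xx0] Xact [X1 XM] Xtrans Xstab] := hX.
have hY : homogeneous Y.
  split.
  - by exists (phi x0); exact: phi_pts.
  - move=> g _ Gg /surj[x Xx <-]; rewrite -phiE //.
    exact/phi_pts/Xact.
  - split=> [_ /surj[x Xx <-]|g h _ Gg Gh /surj[x Xx <-]].
      by rewrite -phiE ?X1 //; exact: SOo41_1.
    rewrite -!phiE ?XM //; first exact: Xact.
    exact: SOo41_mul.
  - move=> _ _ /surj[x Xx <-] /surj[y Xy <-].
    have [g Gg gx] := Xtrans x y Xx Xy.
    by exists g; rewrite // -phiE // gx.
  - move=> _ /surj[x Xx <-].
    rewrite (_ : stabilizer Y (phi x) = stabilizer X x); first exact: Xstab.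
    apply/seteqP; split=> g [Gg gx]; split => //.
      by apply: inj => //; [exact: Xact|rewrite phiE].
    by rewrite -phiE // gx.
have [_ Yact _ _ _] := hY.
(* The inverse of [phi] by choice, with default value [x0] off the points of [Y]. *)
pose psi y := if pselect (gs_pts Y y) is left Yy then s2val (cid2 (surj y Yy))
  else x0.
have psiP y : gs_pts Y y -> gs_pts X (psi y) /\ phi (psi y) = y.
  by move=> Yy; rewrite /psi; case: pselect => // Yy'; case: cid2.
split => //; split; first exact: equivariant_smooth.
exists psi; split.
- apply: equivariant_smooth => //; last by move=> y /psiP[].
  move=> g y Gg Yy; have [Xy phiy] := psiP y Yy.
  have [Xgy phigy] := psiP _ (Yact g y Gg Yy).
  by apply: inj; rewrite ?phiE ?phiy //; exact: Xact.
- by move=> x Xx; have [Xp pp] := psiP _ (phi_pts x Xx); exact: inj.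
- by move=> y /psiP[].
Qed.

Theorem proposition3 (R : realType) :
  [/\ homogeneous (de_sitter R),
      homogeneous (cooriented_spheres R) &
      isomorphic_gspaces (de_sitter R) (cooriented_spheres R)].
Proof.
have dS := de_sitter_homogeneous R.
have [cS diffeo] := equivariant_bijection dS (@polarity_equivariant R)
  (@polarity_cooriented R) (@polarity_surj R) (@polarity_inj R).
split => //; exists (@polarity R); split => //; exact: polarity_equivariant.
Qed.
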